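(* Let $S$ be a reduced commutative semigroup with $0$. Suppose that $\{0\}=\bigcap_{i=1}^n\mathfrak p_i$ is a minimal prime decomposition of $0$, i.e. the $\mathfrak p_i$ are prime ideals of $S$, $\mathfrak p_i\neq\mathfrak p_j$ for all $i\neq j$, and $\bigcap_{i\neq t}\mathfrak p_i\neq\{0\}$ for every $1\le t\le n$. Then $\chi(S)=\omega(S)=n$.
   Context: A commutative semigroup with $0$ is a commutative semigroup $S$ with an element $0$ such that $0s=0$ for all $s\in S$. A zero-divisor is an element $x\in S$ with $xy=0$ for some $y\in S$, $y\neq 0$; $Z(S)$ is the set of zero-divisors. The zero-divisor graph $\Gamma(S)$ is the simple undirected graph with vertex set $Z(S)\setminus\{0\}$, where distinct $x,y$ are adjacent iff $xy=0$. $S$ is reduced if for all $x\in S$ and $n\ge 1$, $x^n=0$ implies $x=0$. A non-empty subset $I\subseteq S$ is an ideal if $xS\subseteq I$ for every $x\in I$; an ideal $\mathfrak p$ is prime if for all $x,y\in S$, $xSy\subseteq\mathfrak p$ implies $x\in\mathfrak p$ or $y\in\mathfrak p$. $\chi(S)$ denotes the chromatic number of $\Gamma(S)$ and $\omega(S)$ denotes the clique number of $\Gamma(S)$ (the number of vertices of a largest complete subgraph).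
   Formalization: The case n = 1 is excluded: there {0} is itself prime, so S has no nonzero zero-divisors, the graph is empty and χ(S) = ω(S) = 0 ≠ 1 (e.g. S = {0,1} under multiplication, the empty intersection being S). *)

(* Defs.v *)
From HB Require Import structures.
From mathcomp Require Import all_boot.
From mathcomp Require Import boolp classical_sets functions cardinality.

Set Implicit Arguments.
Unset Strict Implicit.
Unset Printing Implicit Defensive.

Local Open Scope classical_set_scope.
Local Open Scope card_scope.
Local Open Scope group_scope.

HB.mixin Record Semigroup_isComWithZero S of Semigroup S := {
  szero : S;
  smulC : forall x y : S, x * y = y * x;
  smul0 : forall x : S, szero * x = szero
}.

#[short(type="comSemigroup0Type")]
HB.structure Definition ComSemigroup0 :=
  {S of Semigroup_isComWithZero S & Semigroup S}.

Arguments szero {s}.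
Notation "\0" := (@szero _) (at level 0) : group_scope.

Section Semigroups.
Variable S : comSemigroup0Type.
Implicit Types (x y : S) (I : set S).

(* A semigroup has no unit, so [^+] is unavailable. The last argument of
   [iterop] is its value at exponent 0 and is irrelevant when 0 < n. *)
Definition reduced :=
  forall x (n : nat), (0 < n)%N -> iterop n *%g x x = \0 -> x = \0.

Definition is_ideal I :=
  I !=set0 /\ forall x, I x -> [set x * s | s in [set: S]] `<=` I.

Definition is_prime_ideal I :=
  is_ideal I /\
  forall x y, [set x * s * y | s in [set: S]] `<=` I -> I x \/ I y.

Definition zero_divisors : set S := [set x | exists2 y, y <> \0 & x * y = \0].

Definition minimal_prime_decomposition (n : nat) (p : 'I_n -> set S) :=
  [/\ [set \0] = \bigcap_(i in [set: 'I_n]) p i,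
      forall i, is_prime_ideal (p i),
      forall i j, i <> j -> p i <> p j
    & forall t, \bigcap_(i in [set~ t]) p i <> [set \0]].

End Semigroups.

Arguments zero_divisors {S}.

Record simple_graph (T : Type) := SimpleGraph {
  vertices : set T;
  adj : T -> T -> Prop;
  adj_vertices : forall x y, adj x y -> vertices x /\ vertices y;
  adj_sym : forall x y, adj x y -> adj y x;
  adj_irrefl : forall x, ~ adj x x
}.

Section Graphs.
Variables (T : Type) (G : simple_graph T).

(* [c] is a total function whose values off the vertex set are irrelevant, so
   that a graph with no vertices is colourable with 0 colours. *)
Definition colourable (k : nat) := exists c : T -> nat,
  (forall x, vertices G x -> (c x < k)%N) /\
  (forall x y, adj G x y -> c x <> c y).

(* The graph may be infinite; this asserts in particular that the chromatic
   number is finite, and likewise for the clique number below. *)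
Definition is_chromatic_number (n : nat) :=
  colourable n /\ forall k, colourable k -> (n <= k)%N.

Definition is_clique (C : set T) :=
  C `<=` vertices G /\ forall x y, C x -> C y -> x <> y -> adj G x y.

Definition is_clique_number (n : nat) :=
  (exists2 C, is_clique C & C #= `I_n) /\
  forall C, is_clique C -> C #<= `I_n.

End Graphs.

Section ZeroDivisorGraph.
Variable S : comSemigroup0Type.

Let V : set S := zero_divisors `\ \0.
Let E (x y : S) := [/\ V x, V y, x <> y & x * y = \0].

Let E_vertices x y : E x y -> V x /\ V y.
Proof. by case. Qed.

Let E_sym x y : E x y -> E y x.
Proof. by case=> Vx Vy xy xy0; split=> //; [exact: nesym | rewrite smulC]. Qed.

Let E_irrefl x : ~ E x x.
Proof. by case. Qed.

Definition zero_divisor_graph : simple_graph S :=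
  SimpleGraph E_vertices E_sym E_irrefl.

End ZeroDivisorGraph.

(* Main.v *)
(** Choosing x_t <> 0 in the intersection of the p_i with i <> t gives
    x_t \notin p_t, while x_s * x_t lies in every p_i for s <> t and hence is 0:
    the x_t form a clique of size n. Colouring x <> 0 by an index i with
    x \notin p_i is proper, since x * y = 0 and primeness of p_i force x or y
    into p_i. *)
Require Import Defs.
From mathcomp Require Import all_boot.
From mathcomp Require Import boolp classical_sets functions cardinality.

Set Implicit Arguments.
Unset Strict Implicit.
Unset Printing Implicit Defensive.

Local Open Scope classical_set_scope.
Local Open Scope card_scope.
Local Open Scope group_scope.

(** A proper colouring is injective on a clique, so it embeds [C] into the set of colours; this also
    excludes infinite cliques. *)
Lemma clique_card_le_colours (T : Type) (G : simple_graph T) (k : nat)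
    (C : set T) : colourable G k -> is_clique G C -> C #<= `I_k.
Proof.
move=> [c [c_lt c_adj]] [CV Cadj].
have c_inj : {in C &, injective c}.
  move=> x y; rewrite !inE => Cx Cy cxy; apply: contrapT => xy.
  exact: (c_adj x y (Cadj _ _ Cx Cy xy)).
rewrite -(card_le_eql (inj_card_eq c_inj)); apply: subset_card_le.
by move=> _ [x Cx <-]; exact/c_lt/CV.
Qed.

(** The preceding bound is used twice: on the given clique it forces at least [n] colours, and with
    the given colouring it limits every clique to [n] vertices. *)
Lemma chromatic_clique_number_eq (T : Type) (G : simple_graph T) (n : nat) :
  colourable G n -> (exists2 C, is_clique G C & C #= `I_n) ->
  is_chromatic_number G n /\ is_clique_number G n.
Proof.
move=> col [C Ccl Cn]; split; split=> //; last 2 first.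
- by exists C.
- by move=> D; exact: clique_card_le_colours.
move=> k /clique_card_le_colours /(_ Ccl); rewrite (card_le_eql Cn).
by rewrite card_le_II.
Qed.

Section PrimeDecomposition.
Context {S : comSemigroup0Type}.
Implicit Types (x y : S) (I : set S).

Lemma mulx0 x : x * \0 = \0.
Proof. by rewrite smulC smul0. Qed.

Lemma idealMr I x y : is_ideal I -> I x -> I (x * y).
Proof. by move=> [_ idI] Ix; apply: (idI x Ix); exists y. Qed.

Lemma ideal0 I : is_ideal I -> I \0.
Proof. by move=> idI; have [x Ix] := idI.1; rewrite -(mulx0 x); exact: idealMr. Qed.

(** By commutativity [x * s * y = s * (x * y) = \0] for every [s], and every ideal contains [\0]. *)
Lemma prime_ideal_mul0 I x y : is_prime_ideal I -> x * y = \0 -> I x \/ I y.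
Proof.
move=> [idI prI] xy0; apply: prI => _ [s _ <-].
by rewrite (smulC x) -mulgA xy0 mulx0; exact: ideal0.
Qed.

Variables (n : nat) (p : 'I_n -> set S).
Hypothesis hp : minimal_prime_decomposition p.

Let p_ideal i : is_ideal (p i).
Proof. by case: hp => _ /(_ i) []. Qed.

Lemma in_all_primes x : (forall i, p i x) -> x = \0.
Proof.
case: hp => p0 _ _ _ px; suff: [set \0] x by [].
by rewrite p0 => i _; exact: px.
Qed.

Lemma zero_divisor_graph_colourable : colourable (zero_divisor_graph S) n.
Proof.
(* Colours are naturals because ['I_n] may be empty; [\0] lies in every [p i] and gets the dummy
   colour 0. *)
have /choice [c cP] x : exists k : nat,
    x <> \0 -> exists2 i : 'I_n, k = i & ~ p i x.
  have [->|x0] := pselect (x = \0); first by exists 0%N.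
  have [i pix] : exists i, ~ p i x.
    by apply/existsNP => px; exact/x0/in_all_primes.
  by exists i => _; exists i.
exists c; split=> [x [_ /cP [i ->]] //|x y [[_ x0] [_ y0] _ xy0]].
have [i -> npx] := cP x x0; have [j -> npy] := cP y y0.
move=> /ord_inj ij; subst j.
case: hp => _ /(_ i) pr _ _.
by case: (prime_ideal_mul0 pr xy0).
Qed.

(** For [n = 1] the single prime is the zero ideal, so there are no non-zero zero-divisors and the
    graph has no vertices. *)
Lemma zero_divisor_graph_clique : n <> 1%N ->
  exists2 C, is_clique (zero_divisor_graph S) C & C #= `I_n.
Proof.
move=> n1.
have /choice [x xP] t : exists x, x <> \0 /\ forall i, i <> t -> p i x.
  case: hp => _ _ _ /(_ t) pt; apply: contrapT => nx; apply: pt.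
  (* Ideals contain [\0], so an intersection without non-zero elements would be exactly the zero
     ideal, against minimality. *)
  apply/seteqP; split=> [x px|_ ->] /=; last by move=> i _; exact: ideal0.
  by apply: contrapT => x0; apply: nx; exists x; split=> // i; exact: px.
have x_notin t : ~ p t (x t).
  move=> ptx; apply: (xP t).1; apply: in_all_primes => i.
  by have [->//|] := pselect (i = t); exact: (xP t).2.
have x_inj : injective x.
  move=> s t xst; apply: contrapT => st; apply: (x_notin s).
  by rewrite xst; exact: (xP t).2.
have x_mul s t : s <> t -> x s * x t = \0.
  move=> st; apply: in_all_primes => i.
  have [->|si] := pselect (i = s).
    by rewrite smulC; apply: idealMr => //; exact: (xP t).2.
  by apply: idealMr => //; exact: (xP s).2.
have x_vertex t : vertices (zero_divisor_graph S) (x t).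
  split; last exact: (xP t).1.
  (* To be a zero-divisor, [x t] needs a non-zero annihilator: [x s] for a second index [s], which
     exists because [n <> 1]. *)
  have [s st] : exists s, s <> t.
    apply: contrapT => /forallNP nst; apply: n1; transitivity #|'I_n|; first by rewrite card_ord.
    by apply/eqP/fintype1P; exists t => s; apply: contrapT; exact: nst.
  by exists (x s); [exact: (xP s).1 | rewrite smulC; exact: x_mul].
exists (range x).
  split=> [_ [t _ <-] //|_ _ [s _ <-] [t _ <-] xst].
  split=> //; [exact: x_vertex..|by apply: x_mul => st; apply: xst; rewrite st].
apply: card_eq_trans (inj_card_eq _) _; first by move=> s t _ _; exact: x_inj.
by rewrite card_eq_sym; exact: card_II.
Qed.

End PrimeDecomposition.

Theorem corollary4p2 (S : comSemigroup0Type) (n : nat) (p : 'I_n -> set S)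
    (hS : reduced S) (hp : minimal_prime_decomposition p) (hn : n <> 1%N) :
  is_chromatic_number (zero_divisor_graph S) n /\
  is_clique_number (zero_divisor_graph S) n.
Proof.
apply: chromatic_clique_number_eq.
- exact: zero_divisor_graph_colourable hp.
- exact: zero_divisor_graph_clique hp hn.
Qed.
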